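(* Let $Y$ be a real random variable with $\chi^2(Y,\mathcal N)<\infty$, and let $J$ be a set of positive integers such that $\mathbb{E}H_n(Y)=0$ for all $n\in J$. If \[ \chi^2(Y,\mathcal N)<\inf_{x>0}\frac{(e^{x/2}-1)^2}{e^x-1-\sum_{n\in J}\frac{x^n}{n!}}, \] then $\mathbb{E}e^{tY}<e^{t^2}$ for all real $t\neq0$.
   Context: $\varphi(x)=e^{-x^2/2}/\sqrt{2\pi}$. For a real random variable $Y$ with density $p$, $\chi^2(Y,\mathcal N)=\int_{-\infty}^{\infty}\left(\frac{p(x)}{\varphi(x)}-1\right)^2\varphi(x)\,dx$ (taken to be $+\infty$ if $Y$ has no density). Hermite polynomials $H_n$ are defined by $\sum_{n\geqslant0}\frac{H_n(x)}{n!}z^n=e^{xz-z^2/2}$. *)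

(* Defs.v *)
From HB Require Import structures.
From mathcomp Require Import all_boot all_order all_algebra.
From mathcomp Require Import all_classical all_reals all_analysis.
Set Implicit Arguments. Unset Strict Implicit. Unset Printing Implicit Defensive.
Import Order.TTheory GRing.Theory Num.Theory.
Import numFieldNormedType.Exports.
Local Open Scope classical_set_scope.
Local Open Scope ring_scope.

Definition gauss_pdf {R : realType} (x : R) : R :=
  expR (- (x ^+ 2) / 2) / Num.sqrt (2 * pi).

Definition is_density {d} {T : measurableType d} {R : realType}
  (P : probability T R) (Y : {RV P >-> R}) (p : R -> R) : Prop :=
  measurable_fun setT p /\ (forall x, 0 <= p x) /\
  forall A : set R, measurable A ->
    distribution P Y A = (\int[@lebesgue_measure R]_(x in A) (p x)%:E)%E.

Definition chi2_gauss {d} {T : measurableType d} {R : realType}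
  (P : probability T R) (Y : {RV P >-> R}) : \bar R :=
  match pselect (exists p, is_density Y p) with
  | left h => let p := projT1 (cid h) in
      (\int[@lebesgue_measure R]_x
          (((p x / gauss_pdf x - 1) ^+ 2) * gauss_pdf x)%:E)%E
  | right _ => +oo%E
  end.

(* Hermite polynomials via the generating function
   sum_n H_n(x) z^n / n! = exp(x z - z^2/2), i.e.
   H_n(x) = (d/dz)^n exp(x z - z^2/2) at z = 0. *)
Definition hermite {R : realType} (n : nat) (x : R) : R :=
  derive1n n (fun z : R => expR (x * z - z ^+ 2 / 2)) 0.

(* the function x |-> (e^{x/2}-1)^2 / (e^x - 1 - sum_{n in J} x^n/n!),
   as an extended real (division by 0 gives +oo) *)
Definition hermite_ratio {R : realType} (J : set nat) (x : R) : \bar R :=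
  (((expR (x / 2) - 1) ^+ 2)%:E *
    ((expR x - 1)%:E - \sum_(n <oo | n \in J) (x ^+ n / n`!%:R)%:E)^-1)%E.

Definition hermite_bound {R : realType} (J : set nat) : \bar R :=
  ereal_inf [set hermite_ratio J x | x in [set x : R | 0 < x]].

(* Main.v *)
(** Write [h = p / phi - 1], so that [chi2 = E h(X)^2] for a standard Gaussian
    [X]. For any test function [f], [E f(Y) = E f(X) + E h(X) f(X)], so the
    hypothesis [E H_n(Y) = 0] says that [h] is orthogonal to [H_n] in
    [L^2(phi)], for [n] in [J] and for [n = 0]. Hence subtracting from
    [exp (t x - t^2/2)] the terms [t^n / n! H_n] with [n] in a finite part of
    [J] and [{0}] does not change its product with [h], which is
    [exp (- t^2/2) E exp (t Y) - 1]. By orthogonality of the Hermite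
    polynomials the remainder has squared norm [exp x - sum x^n / n!] with
    [x = t^2], and Cauchy-Schwarz gives
    [(exp (- x/2) E exp (t Y) - 1)^2 <= chi2 (exp x - sum x^n / n!)].
    Only finite sums are expanded; the limit is taken in this inequality. *)
Require Import Defs.
From HB Require Import structures.
From mathcomp Require Import all_boot all_order all_algebra.
From mathcomp Require Import all_classical all_reals all_analysis.
From mathcomp Require Import measurable_realfun ring lra.
Set Implicit Arguments. Unset Strict Implicit. Unset Printing Implicit Defensive.
Import Order.TTheory GRing.Theory Num.Theory.
Import numFieldNormedType.Exports.
Local Open Scope classical_set_scope.
Local Open Scope ring_scope.

(** * Integration against a density *)

Section change_of_density.
Context d (T : measurableType d) (R : realType).
Variables (mu nu : {measure set T -> \bar R}) (p : T -> R).
Hypotheses (mp : measurable_fun [set: T] p) (p0 : forall x, 0 <= p x).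
Hypothesis nuE : forall A, measurable A ->
  nu A = (\int[mu]_(x in A) (p x)%:E)%E.
Local Open Scope ereal_scope.

Import HBNNSimple.

Let mpE : measurable_fun [set: T] (EFin \o p).
Proof. exact/measurable_EFinP. Qed.

Let integral_density_nnsfun (f : {nnsfun T >-> R}) :
  \int[nu]_x (f x)%:E = \int[mu]_x ((f x)%:E * (p x)%:E).
Proof.
under [LHS]eq_integral do rewrite fimfunE -fsumEFin//.
rewrite [LHS]ge0_integral_fsum//; last 2 first.
  - by move=> r; exact/measurable_EFinP/measurableT_comp.
  - by move=> n x _; rewrite EFinM nnfun_muleindic_ge0.
under [RHS]eq_integral.
  move=> x xD; rewrite fimfunE -fsumEFin// muleC ge0_mule_fsumr; last first.
    by move=> r; rewrite EFinM nnfun_muleindic_ge0.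
  over.
rewrite [RHS]ge0_integral_fsum//; last 2 first.
  - move=> r; apply: emeasurable_funM => //.
    by apply/measurable_EFinP; exact/measurableT_comp.
  - move=> n x _; rewrite EFinM mule_ge0//; last by rewrite nnfun_muleindic_ge0.
    by rewrite lee_fin.
apply: eq_fsbigr => r _; rewrite integralZl_indic_nnsfun//= integral_indic//.
rewrite setIT nuE//.
(* A negative value has empty preimage under a nonnegative function, so both sides vanish; the
   remaining [r >= 0] can be moved under the integral. *)
have [r0|r0] := leP 0%R r; last first.
  rewrite (_ : f @^-1` [set r] = set0) ?integral_set0 ?mule0; last first.
    apply/seteqP; split => // x /= fx; have : (0 <= f x)%R by exact: fun_ge0.
    by rewrite fx leNgt r0.
  apply/esym; apply: integral0_eq => x _.
  by rewrite indicE in_set0 mulr0 mule0.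
rewrite -ge0_integralZl//; last 2 first.
  - exact: measurable_funTS.
  - by move=> x _; rewrite lee_fin.
rewrite integral_mkcond; apply: eq_integral => x _.
rewrite patchE indicE; case: ifPn => _; rewrite ?mulr1 ?mulr0 ?mule0//.
by rewrite muleC.
Qed.

Let ge0_integral_density (f : T -> \bar R) :
  measurable_fun [set: T] f -> (forall x, 0 <= f x) ->
  \int[nu]_x f x = \int[mu]_x (f x * (p x)%:E).
Proof.
move=> mf f0.
pose f_ := nnsfun_approx measurableT mf.
transitivity (lim (\int[nu]_x (f_ n x)%:E @[n --> \oo])).
  rewrite -monotone_convergence//=.
  - apply: eq_integral => ? /[!inE] xD; apply/esym/cvg_lim => //=.
    exact: cvg_nnsfun_approx.
  - by move=> n; exact/measurable_EFinP/measurable_funTS.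
  - by move=> n ? _; rewrite lee_fin.
  - by move=> ? _ ? ? mn; rewrite lee_fin; exact/lefP/nd_nnsfun_approx.
transitivity (lim (\int[mu]_x ((f_ n x)%:E * (p x)%:E) @[n --> \oo])).
  by apply: congr_lim; apply/funext => n /=; exact: integral_density_nnsfun.
rewrite -monotone_convergence//=.
- apply: eq_integral => x /[!inE] xD; apply/cvg_lim => //=.
  apply: cvgeZr => //; exact: cvg_nnsfun_approx.
- move=> n; apply: emeasurable_funM => //.
  exact/measurable_EFinP/measurable_funTS.
- by move=> n x _; rewrite mule_ge0 ?lee_fin.
- move=> x _ m n mn; apply: lee_wpmul2r; rewrite lee_fin//.
  exact/lefP/nd_nnsfun_approx.
Qed.

(** No integrability is assumed: multiplication by [p >= 0] commutes with positive and negative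
    parts, so both sides are the same difference of extended reals, even when both parts are
    infinite. *)
Lemma integral_density (f : T -> \bar R) : measurable_fun [set: T] f ->
  \int[nu]_x f x = \int[mu]_x (f x * (p x)%:E).
Proof.
move=> mf; rewrite integralE [RHS]integralE.
rewrite !ge0_integral_density//; [|exact: measurable_funeneg|
  exact: measurable_funepos].
by congr (_ - _); apply: eq_integral => x _;
  rewrite ?funeposE ?funenegE maxe_pMl ?lee_fin// mul0e ?mulNe.
Qed.

End change_of_density.

(** * Hermite polynomials *)

Section hermite_polynomials.
Context (R : realType).
Implicit Types (q : {poly R}) (x z : R) (n : nat).

(** The recurrence through the derivative is chosen because it fits both uses: differentiating the
    generating function in [z], and integrating by parts against the Gaussian. *)
Fixpoint hermite_poly n : {poly R} :=
  if n is m.+1 then 'X * hermite_poly m - (hermite_poly m)^`() else 1.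

Lemma hermite_polyS n :
  hermite_poly n.+1 = 'X * hermite_poly n - (hermite_poly n)^`().
Proof. by []. Qed.

(** Differentiating the recurrence gives [H_{n+1} + (n+1) (X H_n - H_n')] by induction, and the
    bracket is [H_{n+1}] again. *)
Lemma deriv_hermite_poly n : (hermite_poly n.+1)^`() = n.+1%:R *: hermite_poly n.
Proof.
elim: n => [|n IH]; first by rewrite /= mulr1 -polyC1 !derivC subr0 derivX scale1r.
rewrite hermite_polyS derivB derivM derivX mul1r IH derivZ -scalerAr -addrA.
by rewrite -scalerBr -hermite_polyS -[n.+2%:R]natr1 scalerDl scale1r addrC.
Qed.

Lemma hermiteE n x : hermite n x = (hermite_poly n).[x].
Proof.
pose F z := expR (x * z - z ^+ 2 / 2).
have dF z : is_derive z 1 F ((x - z) * F z).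
  by apply: is_derive_eq; rewrite /GRing.scale/= /F; field.
(* The induction needs the derivative at every [z], not only at [0]. Since [F' = (x - z) F], one
   more differentiation reproduces the recurrence at the point [x - z]. *)
suff H : derive1n n F = fun z => (hermite_poly n).[x - z] * F z.
  by rewrite -[hermite n x]/(derive1n n F 0) H /F subr0 mulr0 expr0n mul0r subr0
    expR0 mulr1.
elim: n => [|n IH].
  by apply/funext => z; rewrite derive1n0 /= hornerC mul1r.
apply/funext => z; rewrite derive1nS IH derive1E.
have dH : is_derive z (1 : R) (fun z => (hermite_poly n).[x - z])
    (- (hermite_poly n)^`().[x - z]).
  have -> : (fun z => (hermite_poly n).[x - z]) =
            (horner (hermite_poly n)) \o (fun z => x - z) by [].
  have db : is_derive z (1 : R) (fun z : R => x - z) (-1).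
    by apply: is_derive_eq; rewrite add0r mul1r.
  by apply: is_derive_eq; rewrite mulrN1.
have -> : (fun z => (hermite_poly n).[x - z] * F z) =
  (fun z => (hermite_poly n).[x - z]) * F by [].
rewrite derive_val hermite_polyS; move: (hermite_poly n) => q.
rewrite !hornerE /GRing.scale/=; ring.
Qed.

End hermite_polynomials.

(** * Gaussian mean *)

Section gaussian_mean.
Context (R : realType).
Notation mu := (@lebesgue_measure R).
Implicit Types (f g : R -> R) (x s : R).

Definition gauss_integrable f : Prop :=
  mu.-integrable setT (fun x => (f x * gauss_pdf x)%:E).

Definition gauss_mean f : R := \int[mu]_x (f x * gauss_pdf x).

Lemma gauss_pdf_gt0 x : 0 < gauss_pdf x.
Proof. by rewrite divr_gt0 ?expR_gt0// sqrtr_gt0 mulr_gt0 ?pi_gt0. Qed.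

(** Completing the square: an exponential tilt moves the Gaussian to mean [s], so exponential
    moments reduce to the total mass of [normal_pdf]. *)
Lemma gauss_pdf_expR s x :
  expR (s * x) * gauss_pdf x = expR (s ^+ 2 / 2) * normal_pdf s 1 x.
Proof.
rewrite normal_pdfE ?oner_neq0// /normal_peak /normal_fun /gauss_pdf.
rewrite expr1n mul1r -[pi *+ 2]mulr_natl mulrA -expRD [RHS]mulrCA -expRD mulrC.
by congr (_^-1 * expR _); field.
Qed.

Lemma measurable_gauss_pdf : measurable_fun [set: R] gauss_pdf.
Proof.
apply: continuous_measurable_fun => x; apply: cvgM; last exact: cvg_cst.
apply: continuous_comp; last exact: continuous_expR.
apply: cvgM; last exact: cvg_cst.
by apply: cvgN; exact: exprn_continuous.
Qed.

Lemma gauss_integrable_expR s : gauss_integrable (fun x => expR (s * x)).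
Proof.
rewrite /gauss_integrable; under eq_fun do rewrite gauss_pdf_expR EFinM.
exact/integrableZl/integrable_normal_pdf.
Qed.

Lemma gauss_mean_expR s : gauss_mean (fun x => expR (s * x)) = expR (s ^+ 2 / 2).
Proof.
rewrite /gauss_mean; under eq_Rintegral do rewrite gauss_pdf_expR.
rewrite RintegralZl//; last exact: integrable_normal_pdf.
by rewrite /Rintegral integral_normal_pdf mulr1.
Qed.

Lemma gauss_integrableD f g : gauss_integrable f -> gauss_integrable g ->
  gauss_integrable (fun x => f x + g x).
Proof.
move=> fi gi; rewrite /gauss_integrable.
by under eq_fun do rewrite mulrDl EFinD; exact: integrableD.
Qed.

Lemma gauss_integrableZ k f : gauss_integrable f ->
  gauss_integrable (fun x => k * f x).
Proof.
move=> fi; rewrite /gauss_integrable.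
by under eq_fun do rewrite -mulrA EFinM; exact: integrableZl.
Qed.

Lemma gauss_meanD f g : gauss_integrable f -> gauss_integrable g ->
  gauss_mean (fun x => f x + g x) = gauss_mean f + gauss_mean g.
Proof.
move=> fi gi; rewrite /gauss_mean -RintegralD//.
by apply: eq_Rintegral => x _; rewrite mulrDl.
Qed.

Lemma gauss_meanZ k f : gauss_integrable f ->
  gauss_mean (fun x => k * f x) = k * gauss_mean f.
Proof.
move=> fi; rewrite /gauss_mean -RintegralZl//.
by apply: eq_Rintegral => x _; rewrite mulrA.
Qed.

Lemma gauss_mean_ge0 f : (forall x, 0 <= f x) -> 0 <= gauss_mean f.
Proof.
by move=> f0; apply: Rintegral_ge0 => x _; rewrite mulr_ge0// ltW// gauss_pdf_gt0.
Qed.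

Lemma gauss_integrable_le f g : measurable_fun [set: R] f ->
  (forall x, `|f x| <= g x) -> gauss_integrable g -> gauss_integrable f.
Proof.
move=> mf fg; apply: le_integrable => //.
  apply/measurable_EFinP; apply: measurable_funM => //.
  exact: measurable_gauss_pdf.
move=> x _; rewrite lee_fin !normrM ler_wpM2r//.
by rewrite (le_trans (fg x))// ler_norm.
Qed.

(* [gauss_mean ((u f + v g)^2)] is a nonnegative quadratic form in [u, v]. *)
Lemma gauss_mean_cauchy_schwarz f g :
  gauss_integrable (fun x => f x ^+ 2) -> gauss_integrable (fun x => g x ^+ 2) ->
  gauss_integrable (fun x => f x * g x) ->
  gauss_mean (fun x => f x * g x) ^+ 2 <=
  gauss_mean (fun x => f x ^+ 2) * gauss_mean (fun x => g x ^+ 2).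
Proof.
move=> f2 g2 fg.
set A := gauss_mean (fun x => f x ^+ 2); set C := gauss_mean (fun x => g x ^+ 2).
set B := gauss_mean _.
have A0 : 0 <= A by apply: gauss_mean_ge0 => x; exact: sqr_ge0.
have C0 : 0 <= C by apply: gauss_mean_ge0 => x; exact: sqr_ge0.
have H u v : 0 <= u ^+ 2 * A + 2 * u * v * B + v ^+ 2 * C.
  rewrite -gauss_meanZ// -gauss_meanZ// -gauss_meanZ//.
  rewrite -gauss_meanD; [|exact: gauss_integrableZ..].
  rewrite -gauss_meanD; [|apply: gauss_integrableD|]; try exact: gauss_integrableZ.
  apply: gauss_mean_ge0 => x; rewrite [leRHS](_ : _ = (u * f x + v * g x) ^+ 2).
    exact: sqr_ge0.
  by ring.
(* If [C = 0], the form at [(B, - (A + 1))] equals [- (A + 2) B^2], which forces [B = 0]. Otherwise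
   its value at [(C, - B)] is [C (A C - B^2)]. *)
have [C1|C1] := eqVneq C 0.
  have := mulr_ge0 A0 (sqr_ge0 B); have := H B (- (A + 1)); rewrite C1; lra.
have {C1}C1 : 0 < C by rewrite lt_neqAle eq_sym C1.
rewrite -subr_ge0 -(pmulr_rge0 _ C1); have := H C (- B); lra.
Qed.

End gaussian_mean.

(** * Gaussian integration by parts *)

Section gaussian_integration_by_parts.
Context (R : realType).
Notation mu := (@lebesgue_measure R).
Implicit Types (q : {poly R}) (x s : R).

(** The fundamental theorem of calculus on growing symmetric intervals leaves boundary terms that
    decay exponentially; dominated convergence gives the integral over the line. *)
Lemma Rintegral_derivative_eq0 (G g : R -> R) (C : R) : continuous g ->
  (forall x, is_derive x (1 : R) G (g x)) ->
  mu.-integrable setT (EFin \o g) ->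
  (forall x, `|G x| <= C * expR (- `|x|)) ->
  \int[mu]_x g x = 0.
Proof.
move=> cg dG ig GC.
(* The endpoints use [n.+1] so that the interval is nondegenerate already for [n = 0]. *)
pose I n : set R := `[- n.+1%:R, n.+1%:R]%classic.
have intI n : (\int[mu]_(x in I n) (g x)%:E = (G n.+1%:R - G (- n.+1%:R))%:E)%E.
  have cG x : {for x, continuous G}.
    by apply: differentiable_continuous; exact/derivable1_diffP.
  rewrite EFinB; apply: continuous_FTC2.
  - by rewrite (@lt_trans _ _ 0)// oppr_lt0.
  - exact: continuous_subspaceT.
  - split; first by move=> x _.
    + exact/cvg_at_right_filter/cG.
    + exact/cvg_at_left_filter/cG.
  - by move=> x _; rewrite derive1E derive_val.
have cvI : (\int[mu]_(x in I n) (g x)%:E @[n --> \oo] --> \int[mu]_x (g x)%:E)%E.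
  have mg := measurable_int _ ig.
  have [] // := @dominated_convergence _ _ _ mu setT measurableT
    (fun n => (EFin \o g) \_ (I n)) (EFin \o g) (abse \o (EFin \o g)).
  - move=> n; apply/(measurable_restrictT _ _).1; first exact: measurable_itv.
    exact: measurable_funTS.
  - apply: aeW => x _; apply: cvg_near_cst.
    near=> n; rewrite patchE mem_set// /I/= in_itv/= -ler_norml.
    rewrite (@le_trans _ _ n%:R)//; last by rewrite ler_nat.
    by near: n; exact: nbhs_infty_ger.
  - exact: integrable_abse.
  - apply: aeW => x n _; rewrite patchE; case: ifPn => // _.
    by rewrite /= normr0 lee_fin.
  move=> _ _; apply: cvg_trans; apply: near_eq_cvg; near=> n.
  by rewrite /= -integral_mkcond.
have G0 : G n.+1%:R - G (- n.+1%:R) @[n --> \oo] --> (0 : R).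
  have b : 2 * C * expR (- n%:R) @[n --> \oo] --> (0 : R).
    by rewrite -[0](mulr0 (2 * C)); apply: cvgMr; exact: cvgn_expR.
  apply: norm_cvg0; apply: squeeze_cvgr (cvg_cst 0) b.
  apply: nearW => n; rewrite normr_ge0/= (le_trans (ler_normB _ _))//.
  have C0 : 0 <= C by have := GC 0; rewrite normr0 oppr0 expR0 mulr1; apply: le_trans.
  have E (x : R) : `|x| = n.+1%:R -> `|G x| <= C * expR (- n%:R).
    move=> xn; rewrite (le_trans (GC x))// xn ler_wpM2l// ler_expR lerN2.
    by rewrite ler_nat.
  by rewrite -mulrA mulr_natl mulr2n lerD// E// ?normrN ger0_norm.
have : (\int[mu]_x (g x)%:E = 0)%E.
  move: cvI; under eq_fun do rewrite intI.
  move=> cvI; apply: (cvg_unique _ cvI); first exact: ereal_hausdorff.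
  by apply: cvg_EFin; [exact: nearW|exact: G0].
by rewrite /Rintegral => ->.
Unshelve. all: end_near.
Qed.

(** One class containing polynomials ([s = 0]) and exponentials ([q = 1]), closed under
    differentiation and products. *)
Definition poly_expR s q x : R := q.[x] * expR (s * x).

(** In Horner form each multiplication by the variable costs one factor [exp |x|], because
    [|x| <= 1 + |x| <= exp |x|]. *)
Lemma horner_growth q :
  exists C k : R, [/\ 0 <= C, 0 <= k & forall x, `|q.[x]| <= C * expR (k * `|x|)].
Proof.
elim/poly_ind: q => [|q c [C [k [C0 k0 H]]]].
  by exists 0, 0; split => // x; rewrite horner0 normr0 mul0r.
exists (C + `|c|), (k + 1); split; [exact: addr_ge0|exact: addr_ge0|move=> x].
rewrite !hornerE (le_trans (ler_normD _ _))// mulrDl lerD//.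
  rewrite normrM mulrDl mul1r expRD mulrA ler_pM//.
  by rewrite (le_trans _ (expR_ge1Dx _))// lerDr.
by rewrite ler_peMr// -expR0 ler_expR mulr_ge0// addr_ge0.
Qed.

Lemma continuous_poly_expR s q : continuous (poly_expR s q).
Proof.
move=> x; apply: cvgM; first exact: continuous_horner.
apply: continuous_comp; last exact: continuous_expR.
exact: mulrl_continuous.
Qed.

Lemma gauss_integrable_poly_expR s q : gauss_integrable (poly_expR s q).
Proof.
have [C [k [C0 k0 H]]] := horner_growth q.
(* [exp (s x + k |x|)] is one of the two exponentials according to the sign of [x], hence at most
   their sum. *)
apply: (@gauss_integrable_le _ _
  (fun x => C * (expR ((s + k) * x) + expR ((s - k) * x)))).
- by apply: continuous_measurable_fun; exact: continuous_poly_expR.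
- move=> x; rewrite /poly_expR normrM (ger0_norm (expR_ge0 _)).
  rewrite (le_trans (ler_wpM2r (expR_ge0 _) (H x)))// -mulrA -expRD ler_wpM2l//.
  have [x0|x0] := leP 0 x.
    rewrite ger0_norm// [X in expR X](_ : _ = (s + k) * x); last by ring.
    by rewrite lerDl expR_ge0.
  rewrite ltr0_norm// [X in expR X](_ : _ = (s - k) * x); last by ring.
  by rewrite lerDr expR_ge0.
- by apply/gauss_integrableZ/gauss_integrableD; exact: gauss_integrable_expR.
Qed.

Lemma poly_expR_gauss_tail s q :
  exists C, forall x, `|poly_expR s q x * gauss_pdf x| <= C * expR (- `|x|).
Proof.
have [C [k [C0 k0 H]]] := horner_growth q.
pose a := k + `|s|.
(* The constant comes from [(a + 1) |x| - x^2 / 2 <= (a + 1)^2 / 2]; the extra [1] in [a + 1] pays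
   for the factor [exp (- |x|)]. *)
exists (C * (expR ((a + 1) ^+ 2 / 2) / Num.sqrt (2 * pi))) => x.
rewrite normrM /poly_expR normrM (ger0_norm (expR_ge0 _)).
rewrite (gtr0_norm (gauss_pdf_gt0 x)).
apply: (@le_trans _ _ (C * expR (k * `|x|) * expR (`|s| * `|x|) * gauss_pdf x)).
  rewrite ler_wpM2r ?(ltW (gauss_pdf_gt0 x))// ler_pM// ler_expR -normrM.
  exact: ler_norm.
rewrite [leLHS](_ : _ = C * (expR (a * `|x| - x ^+ 2 / 2) / Num.sqrt (2 * pi))).
  rewrite [leRHS](_ : _ = C *
    (expR ((a + 1) ^+ 2 / 2 - `|x|) / Num.sqrt (2 * pi))); last first.
    by rewrite expRD; ring.
  rewrite ler_wpM2l// ler_wpM2r ?invr_ge0 ?sqrtr_ge0// ler_expR.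
  rewrite -(real_normK (num_real x)); have := sqr_ge0 (`|x| - (a + 1)); lra.
by rewrite /gauss_pdf [a * _]mulrDl !expRD -[- (x ^+ 2 / 2)]mulNr; ring.
Qed.

Lemma is_derive_poly_expR s q x :
  is_derive x (1 : R) (poly_expR s q) (poly_expR s (q^`() + s *: q) x).
Proof.
rewrite (_ : poly_expR s q = horner q * (fun x => expR (s * x)))//.
apply: is_derive_eq; rewrite /poly_expR /GRing.scale/= hornerD hornerZ; ring.
Qed.

Lemma is_derive_gauss_pdf x :
  is_derive x (1 : R) gauss_pdf (- x * gauss_pdf x).
Proof.
apply: is_derive_eq; rewrite /gauss_pdf /GRing.scale/=; field.
by rewrite gt_eqF// sqrtr_gt0 mulr_gt0 ?pi_gt0.
Qed.

(** The difference of the two integrands is the derivative of [q exp (s x) phi], which decays at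
    both ends and so integrates to [0]. *)
Lemma gauss_mean_ibp s q :
  gauss_mean (poly_expR s ('X * q)) = gauss_mean (poly_expR s (q^`() + s *: q)).
Proof.
set q' := q^`() + s *: q.
apply/eqP; rewrite eq_sym -subr_eq0 /gauss_mean -RintegralB//;
  [|exact: gauss_integrable_poly_expR..].
have [C HC] := poly_expR_gauss_tail s q.
have E : (fun x => poly_expR s q' x * gauss_pdf x -
          poly_expR s ('X * q) x * gauss_pdf x) =
         (fun x => poly_expR s (q' - 'X * q) x * gauss_pdf x).
  by apply/funext => x; rewrite /poly_expR hornerD hornerN hornerM hornerX; ring.
rewrite E; apply/eqP; apply: (Rintegral_derivative_eq0 _ _ _ HC).
- move=> x; apply: cvgM; first exact: continuous_poly_expR.
  apply: differentiable_continuous; apply/derivable1_diffP.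
  by have [] := is_derive_gauss_pdf x.
- move=> x; have d1 := is_derive_poly_expR s q x.
  have d2 := is_derive_gauss_pdf x.
  rewrite (_ : (fun x => _) = poly_expR s q * gauss_pdf)//.
  apply: is_derive_eq; rewrite -/q' /poly_expR /GRing.scale/=.
  by rewrite hornerD hornerN hornerM hornerX; ring.
- exact: gauss_integrable_poly_expR.
Qed.

End gaussian_integration_by_parts.

(** * Orthogonality of Hermite polynomials *)

Section hermite_gaussian.
Context (R : realType).
Implicit Types (q r : {poly R}) (s t : R) (n : nat).

Lemma gauss_mean_poly_expRD s q r : gauss_mean (poly_expR s (q + r)) =
  gauss_mean (poly_expR s q) + gauss_mean (poly_expR s r).
Proof.
rewrite -gauss_meanD; [|exact: gauss_integrable_poly_expR..].
by congr gauss_mean; apply/funext => x; rewrite /poly_expR hornerD mulrDl.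
Qed.

Lemma gauss_mean_poly_expRZ s k q : gauss_mean (poly_expR s (k *: q)) =
  k * gauss_mean (poly_expR s q).
Proof.
rewrite -gauss_meanZ; last exact: gauss_integrable_poly_expR.
by congr gauss_mean; apply/funext => x; rewrite /poly_expR hornerZ mulrA.
Qed.

Lemma gauss_mean_poly_expR_sum s (I : Type) (S : seq I) (A : pred I)
    (q : I -> {poly R}) :
  gauss_mean (poly_expR s (\sum_(i <- S | A i) q i)) =
  \sum_(i <- S | A i) gauss_mean (poly_expR s (q i)).
Proof.
apply: (big_morph (fun q => gauss_mean (poly_expR s q))) => [q1 q2|].
  exact: gauss_mean_poly_expRD.
by rewrite -(scale0r 0) gauss_mean_poly_expRZ mul0r.
Qed.

(** Integrating the [X H_n] part by parts produces a term [H_n' q] that cancels the other part of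
    the recurrence. Each use lowers the Hermite index by one and differentiates the cofactor
    [q exp (s x)]. *)
Lemma gauss_mean_hermite_mul s n q :
  gauss_mean (poly_expR s (hermite_poly R n.+1 * q)) =
  gauss_mean (poly_expR s (hermite_poly R n * (q^`() + s *: q))).
Proof.
rewrite hermite_polyS mulrBl -mulrA -scaleN1r gauss_mean_poly_expRD.
rewrite gauss_mean_ibp -gauss_mean_poly_expRD; congr (gauss_mean (poly_expR s _)).
rewrite derivM mulrDr scaleN1r -scalerAr.
by rewrite -[_ + _ + s *: _]addrA [LHS]addrC addKr.
Qed.

(** With cofactor [1], each index lowering only contributes a factor [s], down to the moment
    generating function of the Gaussian. *)
Lemma gauss_mean_hermite_expR s n :
  gauss_mean (poly_expR s (hermite_poly R n)) = s ^+ n * expR (s ^+ 2 / 2).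
Proof.
rewrite -[hermite_poly R n]mulr1; elim: n => [|n IH].
  rewrite expr0 mul1r -gauss_mean_expR; congr gauss_mean; apply/funext => x.
  by rewrite /poly_expR mulr1 -[hermite_poly R 0]/1 hornerC mul1r.
rewrite gauss_mean_hermite_mul -polyC1 derivC add0r -scalerAr.
by rewrite polyC1 gauss_mean_poly_expRZ IH (exprS s n) mulrA.
Qed.

(** At [s = 0] the cofactor [H_{n+1}] becomes [(n+1) H_n], so both indices drop together until one
    is [0]; the factors build the factorial. *)
Lemma gauss_mean_hermite_orthogonal m n :
  gauss_mean (poly_expR 0 (hermite_poly R m * hermite_poly R n)) =
  if m == n then n`!%:R else 0.
Proof.
elim: m n => [|m IH] [|n].
- by rewrite mulr1 gauss_mean_hermite_expR expr0 mul1r expr0n mul0r expR0.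
- by rewrite mul1r gauss_mean_hermite_expR expr0n mul0r.
- by rewrite mulr1 gauss_mean_hermite_expR expr0n mul0r.
- rewrite gauss_mean_hermite_mul scale0r addr0 deriv_hermite_poly -scalerAr.
  rewrite gauss_mean_poly_expRZ IH eqSS; case: ifP => _; last by rewrite mulr0.
  by rewrite factS natrM.
Qed.

Variables (A : pred nat) (N : nat) (t : R).

Definition hermite_trunc : {poly R} :=
  \sum_(0 <= i < N | A i) (t ^+ i / i`!%:R) *: hermite_poly R i.

Definition hermite_remainder (x : R) : R :=
  expR (t * x - t ^+ 2 / 2) - hermite_trunc.[x].

Lemma hermite_remainderE : hermite_remainder = fun x =>
  expR (- (t ^+ 2 / 2)) * poly_expR t 1 x + (-1) * poly_expR 0 hermite_trunc x.
Proof.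
apply/funext => x; rewrite /hermite_remainder /poly_expR -polyC1 hornerC.
by rewrite mul0r expR0 expRD; ring.
Qed.

(** Expanding the square gives members of the class [poly_expR] with exponents [2 t], [t] and [0],
    whose integrability and means are known. *)
Lemma hermite_remainder_sqrE : (fun x => hermite_remainder x ^+ 2) = fun x =>
  expR (- t ^+ 2) * poly_expR (2 * t) 1 x +
  ((- 2 * expR (- (t ^+ 2 / 2))) * poly_expR t hermite_trunc x +
   poly_expR 0 (hermite_trunc * hermite_trunc) x).
Proof.
apply/funext => x; rewrite /hermite_remainder /poly_expR -polyC1 hornerC.
rewrite hornerM mul0r expR0 -[2 * t * x]mulrA mulr_natl mulr2n.
rewrite expRD (_ : - t ^+ 2 = - (t ^+ 2 / 2) - (t ^+ 2 / 2)); last by field.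
by rewrite !expRD; ring.
Qed.

Lemma gauss_integrable_hermite_remainder_sqr :
  gauss_integrable (fun x => hermite_remainder x ^+ 2).
Proof.
rewrite hermite_remainder_sqrE; apply: gauss_integrableD.
  exact/gauss_integrableZ/gauss_integrable_poly_expR.
apply: gauss_integrableD; last exact: gauss_integrable_poly_expR.
exact/gauss_integrableZ/gauss_integrable_poly_expR.
Qed.

Lemma gauss_mean_hermite_remainder_sqr :
  gauss_mean (fun x => hermite_remainder x ^+ 2) =
  expR (t ^+ 2) - \sum_(0 <= i < N | A i) (t ^+ 2) ^+ i / i`!%:R.
Proof.
rewrite hermite_remainder_sqrE gauss_meanD; last 2 first.
- exact/gauss_integrableZ/gauss_integrable_poly_expR.
- apply: gauss_integrableD; last exact: gauss_integrable_poly_expR.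
  exact/gauss_integrableZ/gauss_integrable_poly_expR.
rewrite gauss_meanD; last 2 first.
- exact/gauss_integrableZ/gauss_integrable_poly_expR.
- exact: gauss_integrable_poly_expR.
rewrite !gauss_meanZ; [|exact: gauss_integrable_poly_expR..].
rewrite (gauss_mean_hermite_expR (2 * t) 0) expr0 mul1r.
set S := \sum_(0 <= i < N | A i) (t ^+ 2) ^+ i / i`!%:R.
(* With its prefactor the cross term contributes [- 2 S]; the squared truncation, reduced to its
   diagonal by orthogonality, contributes [S]. *)
have -> : gauss_mean (poly_expR t hermite_trunc) = S * expR (t ^+ 2 / 2).
  rewrite gauss_mean_poly_expR_sum mulr_suml; apply: eq_bigr => i _.
  rewrite gauss_mean_poly_expRZ gauss_mean_hermite_expR -exprM mulnC exprM; ring.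
have -> : gauss_mean (poly_expR 0 (hermite_trunc * hermite_trunc)) = S.
  rewrite mulr_suml gauss_mean_poly_expR_sum /S big_nat_cond [RHS]big_nat_cond.
  apply: eq_bigr => i /andP[/andP[_ iN] Ai].
  rewrite mulr_sumr gauss_mean_poly_expR_sum.
  pose c : R := t ^+ i / i`!%:R.
  transitivity (\sum_(0 <= j < N | A j && (j == i)) (c * (c * i`!%:R))).
    rewrite [RHS]big_mkcondr; apply: eq_bigr => j _.
    rewrite -scalerAl -scalerAr !gauss_mean_poly_expRZ.
    rewrite gauss_mean_hermite_orthogonal eq_sym.
    by case: eqP => [->|]; rewrite // !mulr0.
  rewrite big_nat1_cond_eq Ai iN/= /c -exprM mulnC exprM; field.
  by rewrite pnatr_eq0 -lt0n fact_gt0.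
rewrite (_ : (2 * t) ^+ 2 / 2 = t ^+ 2 + t ^+ 2); last by field.
rewrite -expRD addKr.
have E : expR (- (t ^+ 2 / 2)) * expR (t ^+ 2 / 2) = 1.
  by rewrite -expRD addNr expR0.
rewrite (_ : - 2 * _ * (S * _) =
  - 2 * S * (expR (- (t ^+ 2 / 2)) * expR (t ^+ 2 / 2))); last by ring.
by rewrite E; ring.
Qed.

End hermite_gaussian.

(** * Density relative to the Gaussian *)

Section relative_density.
Context d (T : measurableType d) (R : realType).
Variables (P : probability T R) (Y : {RV P >-> R}) (p : R -> R).
Hypothesis Yp : is_density Y p.
Notation mu := (@lebesgue_measure R).

Definition gauss_rel_density (x : R) : R := p x / gauss_pdf x - 1.
Local Notation h := gauss_rel_density.

Hypothesis chi2_fin : (\int[mu]_x (h x ^+ 2 * gauss_pdf x)%:E < +oo)%E.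

Let mp : measurable_fun [set: R] p. Proof. by case: Yp. Qed.
Let p0 x : 0 <= p x. Proof. by case: Yp => _ []. Qed.

Lemma expectation_density (f : R -> R) : measurable_fun [set: R] f ->
  ('E_P[fun w => f (Y w)] = \int[mu]_x (f x * p x)%:E)%E.
Proof.
move=> mf; have mfE : measurable_fun [set: R] (fun x => (f x)%:E).
  exact/measurable_EFinP.
(* [lebesgue_measure] lives on [measurableTypeR R], whose display is not the
   one of [R]: [Y] is repackaged so that both measures share a type. *)
have mY : measurable_fun [set: T] (Y : T -> measurableTypeR R).
  have mY : measurable_fun [set: T] Y by [].
  by move=> mT A mA; exact: mY.
pose Z : {mfun T >-> measurableTypeR R} :=
  HB.pack (Y : T -> measurableTypeR R) (isMeasurableFun.Build _ _ _ _ _ mY).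
rewrite unlock; transitivity (\int[distribution P Z]_x (f x)%:E)%E.
  rewrite integralE [RHS]integralE; congr (_ - _)%E.
    rewrite ge0_integral_pushforward//; last exact: measurable_funepos.
    by apply: eq_integral => w _; rewrite -funepos_comp.
  rewrite ge0_integral_pushforward//; last exact: measurable_funeneg.
  by apply: eq_integral => w _; rewrite -funeneg_comp.
by rewrite [LHS](integral_density (mu := mu) mp p0)//; case: Yp => _ [].
Qed.

Lemma measurable_gauss_rel_density : measurable_fun [set: R] h.
Proof.
apply: measurable_funB => //; apply: measurable_funM => //.
apply: continuous_measurable_fun => x; apply: cvgV.
  by rewrite gt_eqF// gauss_pdf_gt0.
apply: differentiable_continuous; apply/derivable1_diffP.
by have [] := is_derive_gauss_pdf x.
Qed.

Lemma gauss_integrable_rel_density_sqr : gauss_integrable (fun x => h x ^+ 2).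
Proof.
apply/integrableP; split.
  apply/measurable_EFinP; apply: measurable_funM; last exact: measurable_gauss_pdf.
  by apply: measurable_funX; exact: measurable_gauss_rel_density.
under eq_integral.
  move=> x _; rewrite gee0_abs; first by over.
  by rewrite lee_fin mulr_ge0 ?sqr_ge0// ltW// gauss_pdf_gt0.
exact: chi2_fin.
Qed.

Lemma gauss_integrable_rel_densityM (f : R -> R) : measurable_fun [set: R] f ->
  gauss_integrable (fun x => f x ^+ 2) -> gauss_integrable (fun x => h x * f x).
Proof.
move=> mf f2; apply: (@gauss_integrable_le _ _ (fun x => h x ^+ 2 + f x ^+ 2)).
- by apply: measurable_funM => //; exact: measurable_gauss_rel_density.
- move=> x; rewrite normrM -(real_normK (num_real (h x))).
  rewrite -(real_normK (num_real (f x))).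
  (* [a^2 + b^2 - a b] is [3/4] of the square of [a - b] plus [1/4] of the square of [a + b]. *)
  have := sqr_ge0 (`|h x| - `|f x|).
  have := sqr_ge0 (`|h x| + `|f x|); lra.
- exact: gauss_integrableD gauss_integrable_rel_density_sqr f2.
Qed.

(** This is [p = (h + 1) phi] under the integral; square integrability of [f] makes [h f]
    integrable, so the expectation is finite and splits. *)
Lemma expectation_gauss_mean (f : R -> R) : measurable_fun [set: R] f ->
  gauss_integrable f -> gauss_integrable (fun x => f x ^+ 2) ->
  ('E_P[fun w => f (Y w)] =
   (gauss_mean (fun x => h x * f x) + gauss_mean f)%:E)%E.
Proof.
move=> mf fi f2; have hfi := gauss_integrable_rel_densityM mf f2.
rewrite expectation_density// -gauss_meanD// /gauss_mean /Rintegral fineK.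
  apply: eq_integral => x _; congr EFin; rewrite /gauss_rel_density; field.
  by rewrite gt_eqF// gauss_pdf_gt0.
exact: integrable_fin_num (gauss_integrableD hfi fi).
Qed.

Let poly_expR_sqr s q :
  (fun x => @poly_expR R s q x ^+ 2) = poly_expR (2 * s) (q * q).
Proof.
apply/funext => x; rewrite /poly_expR hornerM -[2 * s * x]mulrA mulr_natl mulr2n.
by rewrite expRD; ring.
Qed.

Let measurable_poly_expR s q : measurable_fun [set: R] (@poly_expR R s q).
Proof. by apply: continuous_measurable_fun; exact: continuous_poly_expR. Qed.

Let gauss_integrable_density_poly_expR s q :
  gauss_integrable (fun x => h x * @poly_expR R s q x).
Proof.
apply: gauss_integrable_rel_densityM; first exact: measurable_poly_expR.
by rewrite poly_expR_sqr; exact: gauss_integrable_poly_expR.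
Qed.

Lemma expectation_poly_expR s q :
  ('E_P[fun w => poly_expR s q (Y w)] =
    (gauss_mean (fun x => h x * poly_expR s q x) + gauss_mean (poly_expR s q))%:E)%E.
Proof.
apply: expectation_gauss_mean; first exact: measurable_poly_expR.
  exact: gauss_integrable_poly_expR.
by rewrite poly_expR_sqr; exact: gauss_integrable_poly_expR.
Qed.

Lemma expectation_expR t : ('E_P[fun w => expR (t * Y w)] =
  (gauss_mean (fun x => h x * poly_expR t 1 x) + expR (t ^+ 2 / 2))%:E)%E.
Proof.
rewrite -[expR (t ^+ 2 / 2)]mul1r -(gauss_mean_hermite_expR t 0).
rewrite -expectation_poly_expR; congr ('E_P[_])%E; apply/funext => w.
by rewrite /poly_expR -polyC1 hornerC mul1r.
Qed.

(** Index [0] needs no moment hypothesis: the law of [Y] and the Gaussian both have total mass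
    [1]. *)
Lemma gauss_mean_density_hermite0 :
  gauss_mean (fun x => h x * poly_expR 0 (hermite_poly R 0) x) = 0.
Proof.
apply: (addIr (gauss_mean (poly_expR 0 (hermite_poly R 0)))); apply: EFin_inj.
rewrite -expectation_poly_expR add0r gauss_mean_hermite_expR expr0 mul1r.
rewrite expr0n mul0r expR0 -[RHS](expectation_cst P); congr ('E_P[_])%E.
apply/funext => w; rewrite /poly_expR -[hermite_poly R 0]/1 -polyC1 hornerC.
by rewrite mul0r expR0 mulr1.
Qed.

Lemma gauss_mean_density_hermite n : (0 < n)%N ->
  ('E_P[fun w => hermite n (Y w)] = 0)%E ->
  gauss_mean (fun x => h x * poly_expR 0 (hermite_poly R n) x) = 0.
Proof.
move=> n0 En; apply: (addIr (gauss_mean (poly_expR 0 (hermite_poly R n)))).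
apply: EFin_inj; rewrite -expectation_poly_expR.
(* For [n > 0] the Gaussian mean of [H_n] vanishes, so [E H_n(Y)] is the pairing with [h] alone. *)
rewrite gauss_mean_hermite_expR expr0n gtn_eqF// mul0r addr0 -[RHS]En.
congr ('E_P[_])%E; apply/funext => w.
by rewrite /poly_expR mul0r expR0 mulr1 hermiteE.
Qed.

Lemma gauss_mean_density_remainder (A : pred nat) N t :
  (forall n, A n ->
    gauss_mean (fun x => h x * poly_expR 0 (hermite_poly R n) x) = 0) ->
  gauss_mean (fun x => h x * hermite_remainder A N t x) =
  expR (- (t ^+ 2 / 2)) * gauss_mean (fun x => h x * poly_expR t 1 x).
Proof.
move=> hA.
have -> : (fun x => h x * hermite_remainder A N t x) = (fun x =>
    expR (- (t ^+ 2 / 2)) * (h x * poly_expR t 1 x) +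
    (-1) * (h x * poly_expR 0 (hermite_trunc A N t) x)).
  by apply/funext => x; rewrite hermite_remainderE; ring.
rewrite gauss_meanD ?gauss_meanZ//; [|exact: gauss_integrableZ..].
rewrite [X in _ + _ * X](_ : _ = 0) ?mulr0 ?addr0// /hermite_trunc.
elim: N => [|N IH].
  rewrite big_geq// -[RHS](mul0r (gauss_mean (fun x => h x * poly_expR 0 0 x))).
  rewrite -gauss_meanZ//; congr gauss_mean; apply/funext => x.
  by rewrite /poly_expR horner0; ring.
rewrite big_mkcond big_nat_recr//= -big_mkcond/=.
case: ifPn => AN; last by rewrite addr0.
rewrite (_ : (fun x => _) = (fun x =>
    h x * poly_expR 0
      (\sum_(0 <= i < N | A i) (t ^+ i / i`!%:R) *: hermite_poly R i) x +
    t ^+ N / N`!%:R * (h x * poly_expR 0 (hermite_poly R N) x))); last first.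
  by apply/funext => x; rewrite /poly_expR hornerD hornerZ; ring.
rewrite gauss_meanD//; last exact: gauss_integrableZ.
by rewrite IH gauss_meanZ// hA// mulr0 addr0.
Qed.

Lemma density_remainder_bound (A : pred nat) N t :
  (forall n, A n ->
    gauss_mean (fun x => h x * poly_expR 0 (hermite_poly R n) x) = 0) ->
  (expR (- (t ^+ 2 / 2)) * gauss_mean (fun x => h x * poly_expR t 1 x)) ^+ 2 <=
  gauss_mean (fun x => h x ^+ 2) *
  (expR (t ^+ 2) - \sum_(0 <= i < N | A i) (t ^+ 2) ^+ i / i`!%:R).
Proof.
move=> hA; rewrite -(gauss_mean_density_remainder N t hA).
rewrite -gauss_mean_hermite_remainder_sqr; apply: gauss_mean_cauchy_schwarz.
- exact: gauss_integrable_rel_density_sqr.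
- exact: gauss_integrable_hermite_remainder_sqr.
- apply: gauss_integrable_rel_densityM.
    rewrite hermite_remainderE; apply: measurable_funD; apply: measurable_funM => //;
    exact: measurable_poly_expR.
  exact: gauss_integrable_hermite_remainder_sqr.
Qed.

End relative_density.

(** * Passage to the limit and the strict bound on the moment generating function *)

Lemma chi2_gaussE d (T : measurableType d) (R : realType)
    (P : probability T R) (Y : {RV P >-> R}) : (chi2_gauss Y < +oo)%E ->
  exists p, [/\ is_density Y p,
    gauss_integrable (fun x => gauss_rel_density p x ^+ 2) &
    chi2_gauss Y = (gauss_mean (fun x => gauss_rel_density p x ^+ 2))%:E].
Proof.
rewrite /chi2_gauss; case: pselect => [hp|]; last by rewrite ltxx.
(* The density must be the one selected by choice in [chi2_gauss]; finiteness has excluded the case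
   without a density. *)
move: (projT2 (cid hp)); move: (projT1 (cid hp)) => p Yp /= pfin.
have pi := gauss_integrable_rel_density_sqr Yp pfin.
by exists p; split => //; rewrite /gauss_mean /Rintegral fineK//;
  exact: integrable_fin_num pi.
Qed.

(** With [D] the denominator of the ratio, letting [N] grow gives [b^2 <= c D], while the strict
    bound on [c] gives [c D < (exp (x/2) - 1)^2]; both bases are nonnegative, so square roots may be
    taken. *)
Lemma hermite_ratio_gt (R : realType) (J : set nat) (x c b : R) :
  0 < x -> 0 <= c -> 0 <= b -> ~ J 0 ->
  (c%:E < hermite_ratio J x)%E ->
  (forall N, (0 < N)%N -> b ^+ 2 <=
    c * (expR x - \sum_(0 <= i < N | (i == 0) || (i \in J)) x ^+ i / i`!%:R)) ->
  (forall N, 0 <=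
    expR x - \sum_(0 <= i < N | (i == 0) || (i \in J)) x ^+ i / i`!%:R) ->
  b < expR (x / 2) - 1.
Proof.
move=> x0 c0 b0 J0 cx bN SN.
have e0 : 0 < expR (x / 2) - 1 by rewrite subr_gt0 expR_gt1 divr_gt0.
pose u i : R := x ^+ i / i`!%:R.
have u0 i : 0 <= u i by rewrite divr_ge0// exprn_ge0// ltW.
pose S N := \sum_(0 <= i < N | i \in J) u i.
(* Index [0] lies outside [J], so it contributes exactly one extra term [1]: this is the [- 1] in
   the denominator of [hermite_ratio]. *)
have SE N : \sum_(0 <= i < N.+1 | (i == 0%N) || (i \in J)) u i = 1 + S N.+1.
  rewrite /S big_ltn_cond//= [in RHS]big_ltn_cond//= memNset// {1}/u expr0 fact0.
  rewrite divr1; congr (_ + _); rewrite big_nat_cond [RHS]big_nat_cond.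
  by apply: eq_bigl => -[|i].
have S1 N : S N <= expR x - 1.
  apply: (@le_trans _ _ (S N.+1)).
    rewrite /S [leRHS]big_mkcond big_nat_recr//= -big_mkcond/= lerDl.
    by case: ifP.
  by have := SN N.+1; rewrite SE; lra.
have sumS N : (\sum_(0 <= i < N | i \in J) (u i)%:E)%E = (S N)%:E.
  by rewrite sumEFin.
have cvS := @is_cvg_nneseries R (fun i => (u i)%:E) (fun i => i \in J) 0
  (fun i _ _ => u0 i).
set l := (\sum_(i <oo | i \in J) (u i)%:E)%E in cx.
have l0 : (0 <= l)%E by apply: nneseries_ge0 => i _ _; rewrite lee_fin.
(* This bound makes the extended series finite, so the denominator becomes the real number
   [D >= 0]. *)
have l1 : (l <= (expR x - 1)%:E)%E.
  by apply: (lime_le cvS); apply: nearW => N; rewrite sumS lee_fin.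
have lfin : l \is a fin_num by rewrite ge0_fin_numE// (le_lt_trans l1)// ltry.
pose D := expR x - 1 - fine l.
have cvSl : S n @[n --> \oo] --> fine l.
  apply: (@fine_cvg _ _ _ _ (fun n => (S n)%:E)); rewrite fineK//.
  have -> : (fun n => (S n)%:E) =
      (fun n => \sum_(0 <= i < n | i \in J) (u i)%:E)%E.
    by apply/funext => N; rewrite sumS.
  exact: cvS.
have D0 : 0 <= D by rewrite subr_ge0 -lee_fin fineK.
have bD : b ^+ 2 <= c * D.
  have cvD : c * (expR x - 1 - S n) @[n --> \oo] --> c * D.
    by apply: cvgMr; apply: cvgB => //; exact: cvg_cst.
  apply: (cvgr_to_ge cvD); near=> n.
  have n0 : (0 < n)%N by near: n; exists 1%N.
  by have := bN n n0; rewrite -(prednK n0) SE opprD addrA.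
have : c * D < (expR (x / 2) - 1) ^+ 2.
  move: cx; rewrite /hermite_ratio -/l -(fineK lfin) -EFinB -/D.
  (* For [D = 0] the ratio is [+oo], but then [bD] already forces [b = 0]. *)
  have [->|Dn0] := eqVneq D 0; first by rewrite mulr0 exprn_gt0.
  have Dp : 0 < D by rewrite lt_neqAle eq_sym Dn0.
  by rewrite inver (negbTE Dn0) -EFinM lte_fin ltr_pdivlMr.
by move=> /(le_lt_trans bD); rewrite ltr_pXn2r// nnegrE ltW.
Unshelve. all: end_near.
Qed.

Theorem theorem9 (d : measure_display) (T : measurableType d) (R : realType)
  (P : probability T R) (Y : {RV P >-> R}) (J : set nat) :
  (chi2_gauss Y < +oo)%E ->
  (forall n, J n -> (0 < n)%N) ->
  (forall n, J n -> ('E_P[fun w => hermite n (Y w)] = 0)%E) ->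
  (chi2_gauss Y < hermite_bound J)%E ->
  forall t : R, t != 0 ->
    ('E_P[fun w => expR (t * Y w)] < (expR (t ^+ 2))%:E)%E.
Proof.
move=> /chi2_gaussE[p [Yp p2 ->]] J0 EJ cJ t t0.
have x0 : 0 < t ^+ 2 by rewrite exprn_even_gt0.
have pfin := integrable_lty measurableT p2.
pose A n := (n == 0%N) || (n \in J).
have hA n : A n -> gauss_mean (fun x =>
    gauss_rel_density p x * poly_expR 0 (hermite_poly R n) x) = 0.
  case/orP => [/eqP->|/set_mem Jn].
    exact: (gauss_mean_density_hermite0 Yp pfin).
  by apply: (gauss_mean_density_hermite Yp pfin) => //; [exact: J0|exact: EJ].
rewrite (expectation_expR Yp pfin)// lte_fin.
set g := gauss_mean _.
set e := expR (t ^+ 2 / 2).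
have e0 : 0 < e by exact: expR_gt0.
have eE : expR (t ^+ 2) = e * e by rewrite -expRD; congr expR; field.
(* Here [x = t^2], so [e = exp (x/2)]. Multiplying by [e] gives [g < e^2 - e], and
   [E exp (t Y) = g + e] is then below [e^2 = exp (t^2)]. *)
have : `|e^-1 * g| < e - 1.
  apply: (@hermite_ratio_gt _ J _
    (gauss_mean (fun x => gauss_rel_density p x ^+ 2))) => //.
  - by apply: gauss_mean_ge0 => x; exact: sqr_ge0.
  - by move/J0.
  - by apply: (lt_le_trans cJ); apply: ereal_inf_lbound; exists (t ^+ 2).
  - move=> N _; rewrite real_normK ?num_real// /e -expRN.
    exact: (density_remainder_bound Yp pfin N t hA).
  - move=> N; rewrite -(@gauss_mean_hermite_remainder_sqr R A).
    by apply: gauss_mean_ge0 => x; exact: sqr_ge0.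
move=> /(le_lt_trans (ler_norm _)); rewrite mulrC ltr_pdivrMr// eE; lra.
Qed.
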